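(* Let $d\ge 3$, $0\le m\le d$, let $n\ge 2$ be an integer all of whose prime factors exceed $7$, and let $a$ be an integer with $\gcd(a,n)=1$. Then $\#\bar{S}_d(m;a;n)=n$.
   Context: For $n\ge 2$ and $a$ coprime to $n$, $H_d(a;n)=\{(x_1,\dots,x_d)\in\mathbb{Z}^d: x_1\cdots x_d\equiv a \bmod n,\ 1\le x_1,\dots,x_d<n\}$, and for $0\le m\le d$, $\bar{S}_d(m;a;n)=\{x_1+\cdots+x_m-x_{m+1}-\cdots-x_d \bmod n : (x_1,\dots,x_d)\in H_d(a;n)\}\subseteq \mathbb{Z}/n\mathbb{Z}$. *)

(* Defs.v *)
From mathcomp Require Import all_boot all_order all_algebra.

Set Implicit Arguments.
Unset Strict Implicit.
Unset Printing Implicit Defensive.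

Import GRing.Theory.
Local Open Scope ring_scope.

(* The coordinates x_1, ..., x_d are indexed by 'I_d, so x_(i+1) is [x i];
   the bound x_i < n is carried by the type 'I_n. *)
Definition Hset (d : nat) (a : int) (n : nat) : {set {ffun 'I_d -> 'I_n}} :=
  [set x : {ffun 'I_d -> 'I_n} |
    [forall i : 'I_d, (1 <= x i)%N]
    && (\prod_(i < d) (x i)%:Z == a %[mod n%:Z])%Z].

Definition signed_sum (d n m : nat) (x : {ffun 'I_d -> 'I_n}) : int :=
  \sum_(i < d | (i < m)%N) (x i)%:Z - \sum_(i < d | (m <= i)%N) (x i)%:Z.

(* 'Z_n is Z/nZ only when 1 < n. *)
Definition Sbar (d m : nat) (a : int) (n : nat) : {set 'Z_n} :=
  [set ((signed_sum m x)%:~R : 'Z_n) | x in Hset d a n].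

(* Main.v *)
Require Import Defs.
From mathcomp Require Import all_boot all_order all_algebra.
From mathcomp Require Import all_field zify ring.

Set Implicit Arguments.
Unset Strict Implicit.
Unset Printing Implicit Defensive.

Import GRing.Theory.
Local Open Scope ring_scope.

(* Absorbing the signs into the x_i and setting all but three of them to 1, it
   suffices to solve x y z = a, x + y + z = c in Z/n for every unit a and every
   c.  By the Chinese remainder theorem and Hensel's lemma this reduces to
   finding a smooth solution modulo each prime p > 7, that is, to showing that
   the cubic (c u - 1)^2 - 4 a u^3 takes a square value at some u <> 0 in F_p.
   The latter is proved in Stepanov's style, by comparing degrees in the
   differential equation of its (p-1)/2-th power, instead of by the Hasse
   bound. *)

(** * Squares in the prime field *)

(** ['X^k - 1] has at most [k] roots, and by Fermat the squares of 1, ..., [k] are already [k]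
    distinct ones, so no root is left for a nonsquare. *)
Lemma euler_criterion (p : nat) (k : nat) (x : 'F_p) :
  prime p -> p = k.*2.+1 -> x ^+ k = 1 -> exists v, x = v ^+ 2.
Proof.
move=> pr_p def_p xk.
have [->|x0] := eqVneq x 0; first by exists 0; rewrite expr0n.
pose s : seq 'F_p := [seq i%:R ^+ 2 | i <- iota 1 k].
have [/mapP[i _ ->]|xs] := boolP (x \in s); first by exists i%:R.
have natF_eq0 (j : nat) : (j%:R == 0 :> 'F_p) = (p %| j)%N.
  by rewrite -(dvdn_pcharf (pchar_Fp pr_p)).
have fermat (v : 'F_p) : v != 0 -> (v ^+ 2) ^+ k = 1.
  move=> v0; rewrite -exprM mul2n.
  apply: (mulIf v0); rewrite mul1r -exprSr -def_p.
  by have := expf_card v; rewrite card_Fp.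
have uniq_s : uniq s.
  rewrite map_inj_in_uniq ?iota_uniq // => i j; rewrite !mem_iota => hi hj.
  wlog le_ij : i j hi hj / (i <= j)%N.
    by move=> W eij; case/orP: (leq_total i j) => h; [|symmetry]; apply: W.
  (* Equal squares force [p] to divide [j - i] or [j + i], both smaller than [p]. *)
  move/eqP; rewrite eq_sym eqf_sqr -subr_eq0 -natrB // natF_eq0.
  rewrite -addr_eq0 -natrD natF_eq0 => /orP[] h.
    case: (posnP (j - i)%N) => [h0|/dvdn_leq /(_ h)]; lia.
  have /dvdn_leq/(_ h) : (0 < j + i)%N by lia.
  lia.
have k_gt0 : (0 < k)%N by case: (k) def_p pr_p => // ->.
have Q0 : 'X^k - 1 != 0 :> {poly 'F_p}.
  by rewrite -size_poly_eq0 size_XnsubC.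
have rootsQ : all (root ('X^k - 1)) (x :: s).
  apply/allP => y; rewrite inE => /orP[/eqP->|/mapP[i]].
    by rewrite /root !(hornerE, hornerXn) xk subrr.
  rewrite mem_iota => hi ->; rewrite /root !(hornerE, hornerXn) fermat ?subrr //.
  by rewrite natF_eq0 gtnNdvd //; lia.
have := max_poly_roots Q0 rootsQ; rewrite /= xs uniq_s size_XnsubC //.
by rewrite size_map size_iota ltnn => /(_ isT).
Qed.

Lemma nonsquare_expr (p : nat) (k : nat) (x : 'F_p) :
  prime p -> p = k.*2.+1 -> (forall v, x != v ^+ 2) -> x ^+ k = -1.
Proof.
move=> pr_p def_p nsq.
have x0 : x != 0 by have := nsq 0; rewrite expr0n.
have : (x ^+ k) ^+ 2 == 1 ^+ 2.
  rewrite expr1n -exprM muln2; apply/eqP/(mulIf x0).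
  by rewrite mul1r -exprSr -def_p; have := expf_card x; rewrite card_Fp.
rewrite eqf_sqr => /orP[/eqP|/eqP//] xk.
by have [v xv] := euler_criterion pr_p def_p xk; have := nsq v; rewrite xv eqxx.
Qed.

(** * Square values of a cubic *)

Lemma size_polyD_leq (R : nzSemiRingType) (f g : {poly R}) n :
  (size f <= n)%N -> (size g <= n)%N -> (size (f + g)%R <= n)%N.
Proof.
by move=> hf hg; rewrite (leq_trans (size_polyD _ _)) // geq_max hf hg.
Qed.

Lemma size_polyM_leq (R : nzSemiRingType) (f g : {poly R}) m n :
  (size f <= m.+1)%N -> (size g <= n)%N -> (size (f * g)%R <= m + n)%N.
Proof. by move=> hf hg; rewrite (leq_trans (size_polyMleq _ _)) //; lia. Qed.

Lemma leq_size_deriv (R : nzSemiRingType) (f : {poly R}) n :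
  (size f <= n.+1)%N -> (size f^`() <= n)%N.
Proof.
move=> hf; apply/leq_sizeP => j hj.
by rewrite coef_deriv nth_default ?mul0rn // (leq_trans hf).
Qed.

(* If f took only nonsquare values off 0, then f^((p-1)/2) would agree with
   1 - 2 X^(p-1) on F_p.  Feeding this into the differential equation
   2 f g' + f' g = 0 of g = f^((p-1)/2) and splitting by degree, which p > 7
   allows, gives X^2 L + 4 f - 2 X f' = 0 with L as below, absurd at 0. *)
Lemma cubic_square_value (p : nat) (f : {poly 'F_p}) :
  prime p -> (7 < p)%N -> (size f <= 4)%N -> f.[0] = 1 ->
  exists u v, u != 0 /\ f.[u] = v ^+ 2.
Proof.
move=> pr_p p_gt7 sf f0.
have [k def_p] : exists k, p = k.*2.+1.
  exists p./2; have := odd_double_half p.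
  by have [p2|->] := even_prime pr_p; lia.
have k_ge4 : (4 <= k)%N by lia.
have [/existsP[u /existsP[v /andP[u0 /eqP fu]]]|noS] :=
  boolP [exists u, exists v, (u != 0) && (f.[u] == v ^+ 2)].
  by exists u, v.
have fk u : u != 0 -> f.[u] ^+ k = -1.
  move=> u0; apply: nonsquare_expr => // v; apply: contraNN noS => fu.
  by apply/existsP; exists u; apply/existsP; exists v; rewrite u0.
pose g := f ^+ k.
pose r := g - (1 - 2%:P * 'X^(k.*2)).
have p0 : p%:R = 0 :> 'F_p by apply: pchar_Fp_0.
have dvd_r : ('X^p - 'X) %| r.
  have -> : 'X^p - 'X = \prod_(x : 'F_p) ('X - x%:P).
    by rewrite -finField_genPoly card_Fp.
  apply: uniq_roots_dvdp; last by rewrite uniq_rootsE index_enum_uniq.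
  apply/allP => u _; rewrite /root /r /g !(hornerE, hornerXn, horner_exp).
  have [->|u0] := eqVneq u 0.
    have k0 : (k == 0)%N = false by lia.
    by rewrite f0 expr1n expr0n double_eq0 k0 mulr0 subr0 subrr.
  rewrite fk //; have -> : u ^+ k.*2 = 1; last by apply/eqP; ring.
  apply: (mulIf u0); rewrite mul1r -exprSr -def_p.
  by have := expf_card u; rewrite card_Fp.
pose h := r %/ ('X^p - 'X).
have def_r : r = h * ('X^p - 'X) by rewrite divpK.
have sf' : (size f^`() <= 3)%N by exact: leq_size_deriv.
have sX n : size ('X^n : {poly 'F_p}) = n.+1 by rewrite size_polyXn.
(* The degree of [r] is at most [3k], and dividing by ['X^p - 'X] lowers it by [2k + 1]. *)
have sh : (size h <= k.-1.+1)%N.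
  have sXp : size ('X^p - 'X : {poly 'F_p}) = p.+1.
    by rewrite size_polyDl ?sX // size_polyN size_polyX ltnS prime_gt1.
  rewrite size_divp; last by rewrite -size_poly_eq0 sXp.
  rewrite sXp leq_subLR; apply: (@leq_trans (3 * k).+1); last by lia.
  apply: size_polyD_leq.
    rewrite (leq_trans (size_poly_exp_leq _ _)) // ltnS leq_mul2r.
    have -> : ((size f).-1 <= 3)%N by case: (size f) sf.
    by rewrite orbT.
  rewrite size_polyN; apply: size_polyD_leq; first by rewrite size_poly1.
  rewrite size_polyN.
  apply: leq_trans (size_polyM_leq (size_polyC_leq1 _) (leqnn _)) _.
  by rewrite sX; lia.
have sh' : (size h^`() <= k.-1)%N by exact: leq_size_deriv.
(* Once [g] and its derivative are written through [h], the left side of the differential equation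
   is ['X^2 * L + B] times ['X^(p-2)], plus [D]. *)
pose L := 2%:P * (f * h^`()) + f^`() * h.
pose B := 4%:P * f - 2%:P * ('X * f^`()).
pose D := f^`() - 2%:P * (f * h) - 'X * L.
have sL : (size L <= k.+2)%N.
  apply: size_polyD_leq.
    apply: (@size_polyM_leq _ _ _ 0); first exact: size_polyC_leq1.
    by apply: leq_trans (size_polyM_leq sf sh') _; lia.
  by apply: leq_trans (size_polyM_leq sf' sh) _; lia.
have sD : (size D <= k + 3)%N.
  apply: size_polyD_leq; last first.
    rewrite size_polyN; apply: leq_trans (@size_polyM_leq _ _ _ 1 _ _ sL) _.
      by rewrite size_polyX.
    by lia.
  apply: size_polyD_leq; first by lia.
  rewrite size_polyN; apply: (@size_polyM_leq _ _ _ 0).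
    exact: size_polyC_leq1.
  by apply: leq_trans (size_polyM_leq sf sh) _; lia.
have kF : k%:R *+ 2 = - 1 :> {poly 'F_p}.
  apply/eqP; rewrite -addr_eq0 -mulrnA natr1 muln2 -def_p -polyC1 -polyCMn p0.
  by rewrite polyC0.
(* The left side is [2k + 1 = p] times [f^k] times the derivative of [f]. *)
have ode : 2%:P * f * g^`() + f^`() * g = 0.
  rewrite /g deriv_exp -mulr_natl.
  have -> : f ^+ k = f * f ^+ k.-1 by rewrite -exprS prednK //; lia.
  transitivity ((k%:R *+ 2 + 1) * (f * f^`() * f ^+ k.-1)); first by ring.
  by rewrite kF addNr mul0r.
have def_g : g = 1 - 2%:P * 'X^(k.*2) + h * ('X^p - 'X).
  by rewrite -def_r /r; ring.
have def_g' : g^`() = 2%:P * 'X^(k.*2.-1) - h + h^`() * ('X^p - 'X).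
  rewrite def_g !derivE.
  rewrite -(mulr_natl 'X^(k.*2.-1)) -(mulr_natl 'X^(p.-1)).
  have -> : p%:R = 0 :> {poly 'F_p} by rewrite -polyC1 -polyCMn p0.
  have -> : k.*2%:R = -1 :> {poly 'F_p} by rewrite -muln2 natrM mulr_natr.
  by ring.
have key : ('X^2 * L + B) * 'X^(k.*2.-1) + D = 0.
  rewrite -ode def_g' def_g /D /B /L.
  have -> : 'X^p = 'X^2 * 'X^(k.*2.-1) :> {poly 'F_p}.
    by rewrite -exprD; congr ('X^_); lia.
  have -> : 'X^(k.*2) = 'X * 'X^(k.*2.-1) :> {poly 'F_p}.
    by rewrite -exprS; congr ('X^_); lia.
  by ring.
have : ('X^2 * L + B) * 'X^(k.*2.-1) + D == 0 by rewrite key.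
(* The size of [D] is at most [k + 3], below the size [2k] of ['X^(k.*2.-1)] because [k >= 4]; hence
   the cofactor of this power vanishes. *)
rewrite rreg_div0; last 2 first.
- by rewrite lead_coefXn; exact: rreg1.
- by rewrite sX; lia.
case/andP => /eqP /(congr1 (horner^~ 0)) e0 _.
(* At 0 only the term [4 * f.[0] = 4] of the cofactor survives. *)
have h4 : 4%:R = 0 :> 'F_p.
  rewrite horner0 in e0; rewrite -[RHS]e0 /B !(hornerE, hornerXn) f0 /=; ring.
have : (p %| 4)%N by rewrite (dvdn_pcharf (pchar_Fp pr_p)) h4.
by move/dvdn_leq; lia.
Qed.

(** * The system over the prime field *)

Lemma natF_neq0 (p j : nat) :
  prime p -> (0 < j < p)%N -> j%:R != 0 :> 'F_p.
Proof.
move=> pr_p /andP[j_gt0 j_ltp].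
by rewrite -(dvdn_pcharf (pchar_Fp pr_p)) gtnNdvd.
Qed.

(* For fixed x, the values y and z are the roots of T^2 - (c - x) T + a / x,
   whose discriminant is f(1 / x) x^2 for the cubic f below. *)
Lemma Fp_prod_sum (p : nat) (a c : 'F_p) :
  prime p -> (7 < p)%N -> a != 0 ->
  exists x y z, x * y * z = a /\ x + y + z = c.
Proof.
move=> pr_p p_gt7 a0.
pose f : {poly 'F_p} := (c%:P * 'X - 1) ^+ 2 - (4 * a)%:P * 'X^3.
have sf : (size f <= 4)%N.
  have s1 : (size (c%:P * 'X - 1)%R <= 2)%N.
    apply: size_polyD_leq; last by rewrite size_polyN size_poly1.
    apply: (@size_polyM_leq _ _ _ 0); first exact: size_polyC_leq1.
    by rewrite size_polyX.
  apply: size_polyD_leq.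
    by rewrite expr2 (leq_trans (size_polyM_leq s1 s1)).
  rewrite size_polyN; apply: (@size_polyM_leq _ _ _ 0).
    exact: size_polyC_leq1.
  by rewrite size_polyXn.
have f0 : f.[0] = 1.
  by rewrite /f !(hornerE, horner_exp) /=; ring.
have [u [v [u0 fu]]] := cubic_square_value pr_p p_gt7 sf f0.
have two0 : 2%:R != 0 :> 'F_p by apply: natF_neq0 => //; lia.
have four0 : 4%:R != 0 :> 'F_p by apply: natF_neq0 => //; lia.
have {}fu : v ^+ 2 = (c * u - 1) ^+ 2 - 4 * a * u ^+ 3.
  by rewrite -fu /f !(hornerE, hornerXn, horner_exp).
exists u^-1, ((c - u^-1 + v / u) / 2), ((c - u^-1 - v / u) / 2).
split; last by field; rewrite u0 two0.
transitivity (((c * u - 1) ^+ 2 - v ^+ 2) / (4 * u ^+ 3)).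
  by field; rewrite ?u0 ?two0 ?four0.
by rewrite fu; field; rewrite ?u0 ?two0 ?four0.
Qed.

(* A solution with x = y = z is the node of the curve; (4x, -x/2, -x/2) is
   then another point of it. *)
Lemma Fp_prod_sum_smooth (p : nat) (a c : 'F_p) :
  prime p -> (7 < p)%N -> a != 0 ->
  exists x y z, [/\ x * y * z = a, x + y + z = c & y != z].
Proof.
move=> pr_p p_gt7 a0.
have [x [y [z [e1 <-]]]] := Fp_prod_sum c pr_p p_gt7 a0.
have z0 : z != 0 by apply: contraNneq a0 => z0; rewrite -e1 z0 mulr0.
rewrite -{a a0}e1.
have [eyz|nyz] := eqVneq y z; last by exists x, y, z.
have [exy|nxy] := eqVneq x y; last by exists z, x, y; split=> //; ring.
have two0 : 2%:R != 0 :> 'F_p by apply: natF_neq0 => //; lia.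
have nine0 : 9%:R != 0 :> 'F_p.
  have -> : 9%:R = 3%:R * 3%:R :> 'F_p by rewrite -natrM.
  by rewrite mulf_neq0 // natF_neq0 //; lia.
(* [4z] goes second so that the last two entries differ, by [9z / 2]. *)
rewrite exy eyz; exists (- z / 2), (4 * z), (- z / 2); split.
- by field.
- by field.
rewrite -subr_eq0; have -> : 4 * z - - z / 2 = 9%:R * z / 2 by field.
by rewrite !mulf_neq0 // invr_eq0.
Qed.

(** * Smooth solutions modulo [n] *)

Lemma Fp_intr_surj (p : nat) (x : 'F_p) : exists z : int, x = z%:~R.
Proof. by exists (x : nat)%:Z; rewrite -pmulrn natr_Zp. Qed.

(* The condition on y - z makes x (z - y), the derivative of x y z along
   (0, 1, -1), a unit. *)
Definition has_smooth_solution (n : nat) (a c : int) : Prop :=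
  exists x y z : int, [/\ (n%:Z %| x * y * z - a)%Z,
    (n%:Z %| x + y + z - c)%Z & coprimez (y - z) n%:Z].

Lemma prime_smooth_solution (p : nat) (a c : int) :
  prime p -> (7 < p)%N -> coprimez a p%:Z ->
  has_smooth_solution p a c.
Proof.
move=> pr_p p_gt7 cop.
have dvdE := dvdz_pcharf (pchar_Fp pr_p).
have copE (b : int) : coprimez b p%:Z = (b%:~R != 0 :> 'F_p).
  by rewrite -dvdE coprimez_sym coprimezE /= prime_coprime.
move: cop; rewrite copE => a0.
have [x [y [z []]]] := Fp_prod_sum_smooth c%:~R pr_p p_gt7 a0.
have [x' ->] := Fp_intr_surj x; have [y' ->] := Fp_intr_surj y.
have [z' ->] := Fp_intr_surj z => e1 e2 e3.
exists x', y', z'; split; rewrite ?copE ?dvdE.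
- by rewrite rmorphB /= !rmorphM /= e1 subrr.
- by rewrite rmorphB /= !rmorphD /= e2 subrr.
- by rewrite rmorphB /= subr_eq0.
Qed.

Lemma coprimez_dvdzB (a b n : int) :
  (n %| a - b)%Z -> coprimez b n -> coprimez a n.
Proof.
case/dvdzP => q /eqP; rewrite subr_eq => /eqP -> /coprimezP[[u v] /= e].
by apply/coprimezP; exists (u, v - u * q) => /=; rewrite -e; ring.
Qed.

(* Hensel: replace (y, z) by (y + t n, z - (t + s) n), where x + y + z = c + s n. *)
Lemma smooth_solution_lift (p n : nat) (a c : int) :
  (p %| n)%N -> coprimez a n%:Z ->
  has_smooth_solution n a c -> has_smooth_solution (p * n) a c.
Proof.
move=> p_n cop [x [y [z [e1 /dvdzP[s e2] cyz]]]].
have cxyz := coprimez_dvdzB e1 cop.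
move: cxyz; rewrite !coprimezMl => /andP[/andP[cx _] _].
have {p_n} [q def_n] : exists q, n%:Z = q * p%:Z.
  by case/dvdnP: p_n => q ->; exists q%:Z; rewrite PoszM.
have copp (b : int) : coprimez b n%:Z -> coprimez b p%:Z.
  by rewrite def_n coprimezMr => /andP[].
case/dvdzP: e1 => r e1.
have : coprimez (x * (y - z)) p%:Z by rewrite coprimezMl !copp.
case/coprimezP=> [[u v] /= uv].
(* Modulo [p * n] the new product minus [a] is [n * (r - x y s - t x (y - z))], as [n^2] vanishes;
   [u] inverts [x (y - z)] modulo [p]. *)
pose t := u * (r - x * y * s).
exists x, (y + t * n%:Z), (z - (t + s) * n%:Z).
split.
- rewrite PoszM; apply/dvdzP.
  exists ((r - x * y * s) * v - x * t * (t + s) * q).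
  transitivity ((x * y * z - a) + n%:Z * (x * t * z - x * y * (t + s))
                - x * t * (t + s) * n%:Z * n%:Z); first by ring.
  rewrite e1.
  have vp : v * p%:Z = 1 - u * (x * (y - z)) by rewrite -uv; ring.
  transitivity (n%:Z * ((r - x * y * s) * (v * p%:Z)
                        - x * t * (t + s) * (q * p%:Z))); last by ring.
  by rewrite vp -def_n /t; ring.
- apply/dvdzP; exists 0; rewrite mul0r.
  transitivity (x + y + z - c - s * n%:Z); first by ring.
  by rewrite e2 subrr.
(* The difference moves by a multiple of [n], so it stays prime to [n], hence to [p]. *)
have cn : coprimez (y + t * n%:Z - (z - (t + s) * n%:Z)) n%:Z.
  apply: coprimez_dvdzB cyz; apply/dvdzP; exists (2 * t + s); ring.
by rewrite PoszM coprimezMr cn copp.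
Qed.

Lemma smooth_solution_chinese (m n : nat) (a c : int) :
  coprime m n -> has_smooth_solution m a c -> has_smooth_solution n a c ->
  has_smooth_solution (m * n) a c.
Proof.
move=> co_mn [x1 [y1 [z1 [m1 m2 m3]]]] [x2 [y2 [z2 [n1 n2 n3]]]].
have co : coprimez m%:Z n%:Z by rewrite coprimezE.
pose w (u v : int) := zchinese m%:Z n%:Z u v.
have wl u v : (m%:Z %| w u v - u)%Z.
  by rewrite -eqz_mod_dvd; apply/eqP/zchinese_modl.
have wr u v : (n%:Z %| w u v - v)%Z.
  by rewrite -eqz_mod_dvd; apply/eqP/zchinese_modr.
(* All three conditions depend only on residues modulo [k]; this is applied with [k] equal to [m]
   and to [n]. *)
have glue (k x y z x' y' z' : int) :
    (k %| x' - x)%Z -> (k %| y' - y)%Z -> (k %| z' - z)%Z ->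
    [/\ (k %| x * y * z - a)%Z, (k %| x + y + z - c)%Z & coprimez (y - z) k] ->
    [/\ (k %| x' * y' * z' - a)%Z, (k %| x' + y' + z' - c)%Z
      & coprimez (y' - z') k].
  move=> /dvdzP[s es] /dvdzP[t et] /dvdzP[r er].
  move=> [/dvdzP[q1 e1] /dvdzP[q2 e2] e3].
  split.
  - apply/dvdzP; exists (q1 + s * y' * z' + x * t * z' + x * y * r).
    rewrite !mulrDl -e1.
    transitivity (x * y * z - a + (s * k) * y' * z' + x * (t * k) * z'
                  + x * y * (r * k)); last by ring.
    by rewrite -es -et -er; ring.
  - apply/dvdzP; exists (q2 + s + t + r); rewrite !mulrDl -e2 -es -et -er; ring.
  apply: coprimez_dvdzB e3; apply/dvdzP; exists (t - r).
  by rewrite mulrBl -et -er; ring.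
have [a1 a2 a3] := glue _ _ _ _ _ _ _ (wl x1 x2) (wl y1 y2)
  (wl z1 z2) (And3 m1 m2 m3).
have [b1 b2 b3] := glue _ _ _ _ _ _ _ (wr x1 x2) (wr y1 y2)
  (wr z1 z2) (And3 n1 n2 n3).
exists (w x1 x2), (w y1 y2), (w z1 z2); rewrite PoszM; split.
- by rewrite Gauss_dvdz // a1.
- by rewrite Gauss_dvdz // a2.
- by rewrite coprimezMr a3.
Qed.

(** Strong induction, splitting off the least prime factor [p]: Hensel lifting applies if [p] still
    divides the cofactor, Chinese remaindering otherwise. *)
Lemma smooth_solution_exists (n : nat) (a c : int) :
  (0 < n)%N -> (forall p : nat, prime p -> (p %| n)%N -> (7 < p)%N) ->
  coprimez a n%:Z -> has_smooth_solution n a c.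
Proof.
elim/ltn_ind: n => n IH n_gt0 hp cop.
have [n_le1|n_gt1] := leqP n 1.
  have -> : n = 1%N by lia.
  by exists 0, 0, 0; rewrite !dvd1z coprimezE coprimen1.
have pr_p := pdiv_prime n_gt1; have p_n := pdiv_dvd n.
set p := pdiv n in pr_p p_n.
have p_gt7 := hp p pr_p p_n.
have [m def_n] : exists m, n = (p * m)%N.
  by case/dvdnP: p_n => m ->; exists m; rewrite mulnC.
have m_gt0 : (0 < m)%N by lia.
have m_n : (m %| n)%N by rewrite def_n dvdn_mull.
move: (cop); rewrite def_n PoszM coprimezMr => /andP[cop_p cop_m].
have hm : forall p : nat, prime p -> (p %| m)%N -> (7 < p)%N.
  by move=> r pr_r r_m; apply: hp => //; exact: dvdn_trans m_n.
have sol_m := IH m _ m_gt0 hm cop_m.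
have m_lt : (m < n)%N by rewrite def_n -[ltnLHS]mul1n ltn_pmul2r // prime_gt1.
have [p_m|p_m] := boolP (p %| m)%N.
  by apply: smooth_solution_lift; last exact: sol_m.
apply: smooth_solution_chinese.
- by rewrite prime_coprime.
- exact: prime_smooth_solution.
exact: sol_m.
Qed.

(** * From triples to points of [Hset] *)

Lemma intr_Zp_eq0 (n : nat) (b : int) :
  (1 < n)%N -> (b%:~R == 0 :> 'Z_n) = (n%:Z %| b)%Z.
Proof.
move=> n_gt1.
have natE k : (k%:R == 0 :> 'Z_n) = (n %| k)%N.
  by rewrite -val_eqE /= val_Zp_nat.
case: b => k; first by rewrite -pmulrn natE.
by rewrite NegzE mulrNz oppr_eq0 -pmulrn natE.
Qed.

Lemma signed_sumE (d n m : nat) (x : {ffun 'I_d -> 'I_n}) :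
  signed_sum m x = \sum_(i < d) (-1) ^+ (m <= i)%N * (x i)%:Z.
Proof.
rewrite [RHS](bigID (fun i : 'I_d => (i < m)%N)) /= /signed_sum -sumrN.
congr (_ + _)%R; first by apply: eq_bigr => i im; rewrite leqNgt im mul1r.
apply: eq_big => [i|i mi]; first by rewrite -leqNgt.
by rewrite mi mulN1r.
Qed.

(** The coordinates are the residues of [e i * Y i], with [Y] the triple followed by [d] ones. The
    signs [e i] cancel in the signed sum and multiply the product by a factor of square 1. *)
Lemma Hset_extend_triple (d n m : nat) (a x y z : int) :
  (1 < n)%N -> coprimez a n%:Z ->
  (n%:Z %| x * y * z - a * \prod_(i < d.+3) (-1) ^+ (m <= i)%N)%Z ->
  exists2 X, X \in Hset d.+3 a n &
    (signed_sum m X)%:~R = (x + y + z + d%:Z)%:~R :> 'Z_n.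
Proof.
move=> n_gt1 cop dvd_n.
pose e (i : nat) : int := (-1) ^+ (m <= i)%N.
(* The default value 1 of [nth] supplies all entries after the third. *)
pose Y (i : nat) : int := nth 1 [:: x; y; z] i.
have n0 : n%:Z != 0 by lia.
have ee i : e i * e i = 1 by rewrite -expr2 sqrr_sign.
have wlt (i : nat) : (`|(e i * Y i %% n%:Z)%Z| < n)%N.
  have := ltz_pmod (e i * Y i) (_ : 0 < n%:Z).
  by have := modz_ge0 (e i * Y i) n0; lia.
pose X := [ffun i : 'I_d.+3 => Ordinal (wlt i)].
have XE (i : 'I_d.+3) : ((X i)%:Z)%:~R = (e i * Y i)%:~R :> 'Z_n.
  rewrite ffunE /= gez0_abs ?modz_ge0 //; apply/eqP.
  by rewrite -subr_eq0 -rmorphB /= intr_Zp_eq0 // -eqz_mod_dvd modz_mod.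
have Y1 i : Y i.+3 = 1 by rewrite /Y /= nth_nil.
have prodY : \prod_(i < d.+3) Y i = x * y * z.
  by rewrite !big_ord_recl big1 => [|i _]; [rewrite mulr1 !mulrA | exact: Y1].
have sumY : \sum_(i < d.+3) Y i = x + y + z + d%:Z.
  rewrite !big_ord_recl (eq_bigr (fun=> 1)) => [|i _]; last exact: Y1.
  rewrite sumr_const card_ord.
  by rewrite /Y /= natz !addrA.
have prodX : (n%:Z %| \prod_(i < d.+3) (X i)%:Z - a)%Z.
  rewrite -intr_Zp_eq0 // rmorphB rmorph_prod /=; under eq_bigr do rewrite XE.
  rewrite -rmorph_prod -rmorphB /= intr_Zp_eq0 // big_split /= prodY.
  set s := \prod_(i < d.+3) e i.
  have ss : s * s = 1 by rewrite -big_split big1 //= => i _; exact: ee.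
  have -> : s * (x * y * z) - a = s * (x * y * z - a * s).
    by rewrite mulrBr [s * (a * s)]mulrCA ss mulr1.
  exact: dvdz_mull.
exists X.
  rewrite inE eqz_mod_dvd prodX andbT; apply/forallP => i; rewrite lt0n.
  (* A zero coordinate would make [n] divide [a], against coprimality and [n > 1]. *)
  apply/eqP => Xi0; move: prodX.
  rewrite (bigD1 i) //= Xi0 mul0r sub0r rpredN => na.
  have : coprimez n%:Z n%:Z by apply: coprimez_dvdzB cop; rewrite rpredB.
  by rewrite coprimezE /coprime gcdnn /=; lia.
rewrite signed_sumE -sumY !rmorph_sum; apply: eq_bigr => i _ /=.
by rewrite rmorphM /= XE -rmorphM /= mulrA ee mul1r.
Qed.

Theorem theorem4p1 (d m n : nat) (a : int) (hd : (3 <= d)%N) (hm : (m <= d)%N)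
    (hn : (2 <= n)%N) (hp : forall p : nat, prime p -> (p %| n)%N -> (7 < p)%N)
    (ha : coprimez a n%:Z) :
  #|Sbar d m a n| = n.
Proof.
case: d hd {hm} => [|[|[|d]]] // _.
suff -> : Sbar d.+3 m a n = [set: 'Z_n] by rewrite cardsT card_ord Zp_cast.
apply/setP => c; rewrite [RHS]inE; apply/imsetP.
pose s := \prod_(i < d.+3) (-1) ^+ (m <= i)%N : int.
have cop : coprimez (a * s) n%:Z.
  rewrite coprimezMl ha; apply: (big_ind (fun b : int => coprimez b n%:Z)).
  - by rewrite coprimezE coprime1n.
  - by move=> b1 b2 h1 h2; rewrite coprimezMl h1.
  by move=> i _; case: (m <= i)%N; rewrite coprimezE coprime1n.
have n_gt0 : (0 < n)%N by lia.
(* Here [d] counts the coordinates beyond the third; they contribute [d] to the signed sum, which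
   leaves [c - d] for the triple. *)
have [x [y [z [e1 e2 _]]]] :=
  smooth_solution_exists ((c : nat)%:Z - d%:Z) n_gt0 hp cop.
have [X XH sX] := Hset_extend_triple hn ha e1.
exists X => //; apply/eqP; rewrite sX eq_sym -subr_eq0.
rewrite -(natr_Zp c) pmulrn -rmorphB /= intr_Zp_eq0 //.
by move: e2; rewrite opprB addrA.
Qed.
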